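(* Let $\mathbf{A}$ be an epireflective subcategory of $\mathbf{Top}$ with $I_2\notin\mathbf{A}$ and let $\mathbf{B}$ be an HAD-class in $\mathbf{A}$. If $\mathbf{B}$ contains a prime space, then $\mathbf{B}$ is closed under the formation of prime factors.
   Context: $\mathbf{Top}$ is the category of topological spaces and continuous maps. All subcategories are full and isomorphism-closed (so they are identified with classes of spaces), and every subcategory of $\mathbf{Top}$ is assumed to contain at least one space with at least two points. A subcategory of $\mathbf{Top}$ is epireflective in $\mathbf{Top}$ if and only if it is closed under topological products and subspaces. $I_2$ is the two-point indiscrete space. A class $\mathbf{B}\subseteq\mathbf{A}$ is an AD-class in $\mathbf{A}$ if it is additive (closed under topological sums, i.e. disjoint unions) and divisible in $\mathbf{A}$ (if $q\colon X\to Y$ is a quotient map with $X\in\mathbf{B}$ and $Y\in\mathbf{A}$, then $Y\in\mathbf{B}$). It is an HAD-class in $\mathbf{A}$ if moreover it is hereditary, i.e. closed under subspaces. A prime space is a space with precisely one accumulation point (i.e. precisely one non-isolated point). For a space $X$ and $a\in X$, the prime factor $X_a$ of $X$ at $a$ is the space on the same set in which all points different from $a$ are isolated and the neighborhoods of $a$ are the same as in $X$. A class $\mathbf{B}$ is closed under the formation of prime factors if $X_a\in\mathbf{B}$ for all $X\in\mathbf{B}$ and $a\in X$. *)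

(* Defs.v *)
From HB Require Import structures.
From mathcomp Require Import all_boot all_classical.
From mathcomp Require Import topology.

Set Implicit Arguments.
Unset Strict Implicit.
Unset Printing Implicit Defensive.

Local Open Scope classical_set_scope.

Definition homeomorphic (X Y : topologicalType) : Prop :=
  exists (f : X -> Y) (g : Y -> X),
    [/\ continuous f, continuous g, cancel f g & cancel g f].

Definition quotient_map (X Y : topologicalType) (q : X -> Y) : Prop :=
  range q = [set: Y] /\ forall U : set Y, open U <-> open (q @^-1` U).

Definition epimorphism (X Y : topologicalType) (r : X -> Y) : Prop :=
  continuous r /\
  forall (Z : topologicalType) (g h : Y -> Z),
    continuous g -> continuous h -> g \o r = h \o r -> g = h.

(* A full subcategory of Top is identified with its class of objects. *)
Definition space_class := topologicalType -> Prop.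

(* Standing conventions: subcategories are isomorphism-closed and contain a
   space with at least two points. *)
Record subcategory (C : space_class) : Prop := Subcategory {
  subcategory_iso : forall X Y : topologicalType,
    homeomorphic X Y -> C X -> C Y;
  subcategory_nontrivial :
    exists2 X : topologicalType, C X & exists x y : X, x <> y
}.

Definition reflection (A : space_class) (X Y : topologicalType)
    (r : X -> Y) : Prop :=
  [/\ A Y, continuous r &
      forall (Z : topologicalType) (f : X -> Z), A Z -> continuous f ->
        exists! g : Y -> Z, continuous g /\ f = g \o r].

(* For such a class this is equivalent to closure under topological products
   and subspaces. *)
Definition epireflective (A : space_class) : Prop :=
  subcategory A /\
  forall X : topologicalType, exists (Y : topologicalType) (r : X -> Y),
    reflection A r /\ epimorphism r.

Definition additive_class (B : space_class) : Prop :=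
  forall (I : choiceType) (X : I -> topologicalType),
    (forall i, B (X i)) -> B {i : I & X i}.

Definition divisible_in (A B : space_class) : Prop :=
  forall (X Y : topologicalType) (q : X -> Y),
    quotient_map q -> B X -> A Y -> B Y.

Definition hereditary_class (B : space_class) : Prop :=
  forall (X : topologicalType) (S : set X), B X -> B (set_type S).

Record AD_class (A B : space_class) : Prop := ADClass {
  AD_subcategory : subcategory B;
  AD_sub : forall X, B X -> A X;
  AD_additive : additive_class B;
  AD_divisible : divisible_in A B
}.

Definition HAD_class (A B : space_class) : Prop :=
  AD_class A B /\ hereditary_class B.

Definition I2 : Type := bool.

HB.instance Definition _ := Choice.copy I2 bool.

Section I2_topology.

Definition I2_open : set_system I2 := [set U | U = set0 \/ U = setT].

Let I2_openT : I2_open setT.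
Proof. by right. Qed.

Let I2_openI : setI_closed I2_open.
Proof.
move=> U V [->|->] [->|->]; rewrite ?set0I ?setI0 ?setIT;
  by [left | right].
Qed.

Let I2_open_bigU (J : Type) (f : J -> set I2) :
  (forall j, I2_open (f j)) -> I2_open (\bigcup_j f j).
Proof.
move=> fo; have [[j fj]|nf] := pselect (exists j, f j = setT).
  by right; apply/seteqP; split=> // x _; exists j => //; rewrite fj.
left; apply/seteqP; split=> // x [j _].
by case: (fo j) => [->|fj] // _; apply: nf; exists j.
Qed.

HB.instance Definition _ :=
  isOpenTopological.Build I2 I2_openT I2_openI I2_open_bigU.

End I2_topology.

Definition prime_space (X : topologicalType) : Prop :=
  exists! a : X, limit_point [set: X] a.

Definition prime_factor (X : topologicalType) (a : X) : Type := X.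

Section prime_factor_topology.
Variables (X : topologicalType) (a : X).

HB.instance Definition _ := Choice.copy (prime_factor a) X.

Definition prime_factor_nbhs (x : prime_factor a) :
    set_system (prime_factor a) :=
  if x == a then @nbhs X X a else principal_filter x.

HB.instance Definition _ := hasNbhs.Build (prime_factor a) prime_factor_nbhs.

Let prime_factor_nbhs_proper x : ProperFilter (prime_factor_nbhs x).
Proof.
rewrite /prime_factor_nbhs; case: eqP => _; first exact: (@nbhs_pfilter X).
exact: principal_filter_proper.
Qed.

Let prime_factor_nbhs_singleton x U : prime_factor_nbhs x U -> U x.
Proof.
rewrite /prime_factor_nbhs; case: eqP => [->|_]; first exact: (@nbhs_singleton X).
by move/principal_filterP.
Qed.

Let prime_factor_nbhs_nbhs x U :
  prime_factor_nbhs x U -> prime_factor_nbhs x (prime_factor_nbhs^~ U).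
Proof.
rewrite {1 2}/prime_factor_nbhs; case: eqP => [_|/eqP xa] nU; last first.
  apply/principal_filterP; rewrite /prime_factor_nbhs (negbTE xa).
  exact: nU.
apply: (@filterS X (nbhs a) _ U) => // y Uy.
rewrite /prime_factor_nbhs; case: eqP => // _.
exact/principal_filterP.
Qed.

HB.instance Definition _ :=
  Nbhs_isNbhsTopological.Build (prime_factor a) prime_factor_nbhs_proper
    prime_factor_nbhs_singleton prime_factor_nbhs_nbhs.

End prime_factor_topology.

Definition closed_under_prime_factors (B : space_class) : Prop :=
  forall (X : topologicalType) (a : X), B X -> B (prime_factor a).

(* Main.v *)
(* Attach to every point x of X a copy of the prime space P along its
   accumulation point p. The resulting space Q is a quotient of a sum of spaces
   of B. Its topology is initial with respect to the projection to X, the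
   collapses onto the copies of P, and maps to the two-point discrete space,
   and these maps separate points, so Q lies in A, hence in B. In the subspace
   of Q made of (a, p) and of the points (x, b) with x <> a and b <> p, all
   points but (a, p) are isolated, and its projection to X_a is a quotient map:
   a neighborhood of (a, p) in Q contains, for all x in a neighborhood of a in
   X, a neighborhood of p in the copy of P at x, hence some (x, b) with
   b <> p. *)
From HB Require Import structures.
Require Import Defs.
From mathcomp Require Import all_boot all_classical.
From mathcomp Require Import topology.

Set Implicit Arguments.
Unset Strict Implicit.
Unset Printing Implicit Defensive.

Local Open Scope classical_set_scope.

(** * Maps into indiscrete spaces and a membership criterion for epireflective classes *)

Lemma I2_nbhs (x : I2) (U : set I2) : nbhs x U -> U = setT.
Proof.
rewrite nbhsE => -[V [oV Vx] VU].
have [V0|VT] : V = set0 \/ V = setT by exact: oV.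
  by rewrite V0 in Vx.
by apply/seteqP; split=> // y _; apply: VU; rewrite VT.
Qed.

Lemma I2_continuous (X : topologicalType) (f : X -> I2) : continuous f.
Proof. by move=> x U /I2_nbhs ->; exact: filterT. Qed.

(** The indicator of the range and a constant map into [I2] are both continuous and agree after
    [r]. *)
Lemma epimorphism_surjective (X Y : topologicalType) (r : X -> Y) :
  epimorphism r -> forall y, exists x, r x = y.
Proof.
move=> [_ epir] y.
have : (fun y => `[< exists x, r x = y >] : I2) = (fun=> true : I2).
  apply: epir; try exact: I2_continuous.
  by apply/funext => x; apply/asboolP; exists x.
by move/(congr1 (@^~ y))/asboolP.
Qed.

(* The filter condition says that Z carries the initial topology for the
   continuous maps into spaces of A. *)
Lemma epireflective_initial (A : space_class) (Z : topologicalType) :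
  epireflective A ->
  (forall z z' : Z,
    (forall (Y : topologicalType) (f : Z -> Y),
      A Y -> continuous f -> f z = f z') -> z = z') ->
  (forall (z : Z) (F : set_system Z), Filter F ->
    (forall (Y : topologicalType) (f : Z -> Y),
      A Y -> continuous f -> f @ F --> f z) -> F --> z) ->
  A Z.
Proof.
move=> [isoA reflA] injZ initZ.
have [Y [r [[AY rc univ] /epimorphism_surjective/choice[s rs]]]] := reflA Z.
have factor (T : topologicalType) (f : Z -> T) : A T -> continuous f ->
    exists2 g : Y -> T, continuous g & f = g \o r.
  by move=> AT fc; have [g [[gc fg] _]] := univ T f AT fc; exists g.
have sr : cancel r s.
  by move=> z; apply: injZ => T f AT /(factor _ _ AT)[g _ ->] /=; rewrite rs.
suff YZ : homeomorphic Y Z by exact: subcategory_iso isoA _ _ YZ AY.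
exists s, r; split=> // y.
(* Continuity of [s]: each [f] factors as [g \o r], so [f \o s] is the continuous map [g]. *)
apply: initZ => T f AT /(factor _ _ AT)[g gc ->] U /=.
change (nbhs ((g \o (r \o s)) y) U -> nbhs y ((g \o (r \o s)) @^-1` U)).
have -> : r \o s = id by apply/funext => y'; exact: rs.
exact: gc.
Qed.

(** Otherwise [f] is a continuous injection of [I2] into [X]; every filter converges in [I2], so the
    criterion would put [I2] in [A]. *)
Lemma not_indistinguishable (A : space_class) (X : topologicalType) (x y : X) :
  epireflective A -> ~ A I2 -> A X -> x <> y ->
  (exists2 U, nbhs x U & ~ U y) \/ (exists2 U, nbhs y U & ~ U x).
Proof.
move=> epiA I2A AX xy; apply: contrapT => /not_orP[xNy yNx]; apply: I2A.
pose f (b : I2) := if b then x else y.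
have fc : continuous f.
  move=> b U nU.
  apply: (@filterS _ (nbhs b) _ setT) => [b' _|]; last exact: filterT.
  case: b b' nU => -[] /=; rewrite /f /=.
  - exact: nbhs_singleton.
  - by move=> nU; apply: contrapT => nUy; apply: xNy; exists U.
  - by move=> nU; apply: contrapT => nUx; apply: yNx; exists U.
  - exact: nbhs_singleton.
apply: (epireflective_initial epiA) => [b b' /(_ _ _ AX fc)|b F FF _ U].
  by case: b b' => -[] //= e; case: xy; rewrite e.
by move/I2_nbhs ->; exact: filterT.
Qed.

Lemma isolated_nbhs (X : topologicalType) (a : X) :
  ~ limit_point setT a -> nbhs a [set a].
Proof.
by rewrite not_limit_pointE => -[U aU]; rewrite setTI => /filterS; exact.
Qed.

Lemma set_type_nbhsP (X : topologicalType) (S : set X) (z : S) (W : set S) :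
  nbhs z W <-> exists2 V : set X, nbhs (val z) V & val @^-1` V `<=` W.
Proof.
split.
  rewrite nbhsE => -[_ [[V oV <-] Vz] VW]; exists V => //.
  by exists V.
case=> V nV VW; apply: (@filterS _ (nbhs z) _ _ _ VW).
exact: (@initial_continuous _ _ (set_val : S -> X) z V nV).
Qed.

(* The pair (x, b) is the point b of the copy of P attached at x, and (x, p) is
   the point x of X. *)
Definition attachment (X P : topologicalType) (p : P) : Type := (X * P)%type.

(** * The topology of the attachment *)

Section attachment_topology.
Variables (X P : topologicalType) (p : P).

HB.instance Definition _ := Choice.copy (attachment X p) (X * P)%type.

(** Unlike in a product, the neighborhood of [p] may vary with [y]. *)
Definition attachment_nbhs (q : attachment X p) :
    set_system (attachment X p) :=
  if q.2 == p then
    fun W => \forall y \near q.1, \forall b \near p, W (y, b)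
  else principal_filter q.

HB.instance Definition _ := hasNbhs.Build (attachment X p) attachment_nbhs.

Let attachment_nbhs_proper q : ProperFilter (attachment_nbhs q).
Proof.
rewrite /attachment_nbhs; case: eqP => _; last exact: principal_filter_proper.
apply: Build_ProperFilter_ex => [W nW|].
  by have [y /filter_ex[b Wyb]] := filter_ex nW; exists (y, b).
split=> [|U V nU nV|U V UV]; first by apply: filterE => y; exact: filterE.
  by apply: filterS2 nU nV => y; exact: filterS2.
by apply: filterS => y; apply: filterS => b; exact: UV.
Qed.

Let attachment_nbhs_singleton q W : attachment_nbhs q W -> W q.
Proof.
rewrite /attachment_nbhs; case: eqP => [|_]; last by move/principal_filterP.
by case: q => x _ /= -> /nbhs_singleton/nbhs_singleton.
Qed.

Let attachment_nbhs_nbhs q W :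
  attachment_nbhs q W -> attachment_nbhs q (attachment_nbhs^~ W).
Proof.
rewrite {1 2}/attachment_nbhs; case: eqP => [_|/eqP qp] nW; last first.
  by apply/principal_filterP; rewrite /attachment_nbhs (negbTE qp).
(* The condition on [W] persists at all [y] near [q.1], as [(y, p)] requires; the other [(y, b)]
   only have to lie in [W]. *)
move/nbhs_interior: (nW); apply: filterS => y nyW.
move/nbhs_singleton: (nyW); apply: filterS => b Wyb.
rewrite /attachment_nbhs /=; case: eqP => // _.
exact/principal_filterP.
Qed.

HB.instance Definition _ :=
  Nbhs_isNbhsTopological.Build (attachment X p) attachment_nbhs_proper
    attachment_nbhs_singleton attachment_nbhs_nbhs.

Lemma attachment_nbhs_base (x : X) (W : set (attachment X p)) :
  nbhs ((x, p) : attachment X p) W <->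
  \forall y \near x, \forall b \near p, W (y, b).
Proof. by rewrite {1}/nbhs /= /attachment_nbhs /= eqxx. Qed.

Lemma attachment_nbhs_isolated (x : X) (b : P) (W : set (attachment X p)) :
  b <> p -> nbhs ((x, b) : attachment X p) W <-> W (x, b).
Proof.
move=> /eqP bp; rewrite {1}/nbhs /= /attachment_nbhs /= (negbTE bp).
exact: principal_filterP.
Qed.

End attachment_topology.

(** * The attachment as a member of [A] and as a quotient of a sum *)

Section attachment_maps.
Variables (X P : topologicalType) (p : P).

Lemma attachment_fst_continuous :
  continuous (fst : attachment X p -> X).
Proof.
move=> [x b] U xU; have [->|bp] := pselect (b = p).
  by apply/attachment_nbhs_base; apply: filterS xU => y Uy; exact: filterE.
by apply/(attachment_nbhs_isolated _ _ bp); exact: nbhs_singleton xU.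
Qed.

Definition attachment_collapse (x : X) (q : attachment X p) : P :=
  if q.1 == x then q.2 else p.

Lemma attachment_collapse_continuous (x : X) :
  continuous (attachment_collapse x).
Proof.
move=> [y b] U; have [->|bp] := pselect (b = p) => nU; last first.
  by apply/(attachment_nbhs_isolated _ _ bp); exact: nbhs_singleton nU.
have pU : nbhs p U by move: nU; rewrite /attachment_collapse /=; case: ifP.
apply/attachment_nbhs_base; apply: filterE => y'; apply: filterS (pU) => b' Ub'.
rewrite /attachment_collapse /=; case: ifP => // _.
exact: nbhs_singleton pU.
Qed.

Hypothesis isoP : forall b, b <> p -> nbhs b [set b].

(* For a neighborhood W of (x, p), the function tests membership in a clopen
   set which coincides with W over a neighborhood of x in X. *)
Lemma attachment_clopen_continuous (W : set (attachment X p)) :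
  continuous (fun q : attachment X p =>
    `[< (\forall b \near p, W (q.1, b)) -> W q >]).
Proof.
move=> [x b] U nU; have [bp|bp] := pselect (b = p); last first.
  by apply/(attachment_nbhs_isolated _ _ bp); exact: nbhs_singleton nU.
have Ut : U true.
  have := nbhs_singleton nU; rewrite bp; case: asboolP => // -[].
  exact: nbhs_singleton.
(* Over [y] the function is true near [p] if [W] holds there, and true everywhere if the premise
   fails. *)
rewrite bp; apply/attachment_nbhs_base; apply: filterE => y.
have [Wy|nWy] := pselect (\forall c \near p, W (y, c)).
  by apply: filterS Wy => c Wyc /=; rewrite asboolT.
by apply: filterE => c /=; rewrite asboolT.
Qed.

Lemma attachment_epireflective (A : space_class) :
  epireflective A -> A X -> A P -> A bool -> A (attachment X p).
Proof.
move=> epiA AX AP Abool.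
apply: (epireflective_initial epiA) => [[x b] [y c] e|[x b] F FF cvgF W nW].
  have xy : x = y := e _ _ AX attachment_fst_continuous.
  rewrite -xy in e *; congr pair.
  have := e _ _ AP (attachment_collapse_continuous (x := x)).
  by rewrite /attachment_collapse /= eqxx.
have [bp|bp] := pselect (b = p).
  rewrite bp in cvgF nW *; move/attachment_nbhs_base: nW => nW.
  (* [Ffst] yields the premise of the implication tested in [Fclopen]. *)
  have Ffst := cvgF _ _ AX attachment_fst_continuous _ nW.
  have := cvgF _ _ Abool (attachment_clopen_continuous (W := W)) [set true].
  rewrite /= asboolT; last by move=> /nbhs_singleton.
  have t1 : nbhs true [set true] by exact/principal_filterP.
  move=> /(_ t1) Fclopen.
  apply: (@filterS2 _ F _ _ _ _ _ Ffst Fclopen) => q /= Wq.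
  by move/asboolP; exact.
(* As [b <> p], only [(x, b)] collapses to [b]. *)
have := cvgF _ _ AP (attachment_collapse_continuous (x := x)) [set b].
rewrite {1}/attachment_collapse /= eqxx => /(_ (isoP bp)) Fb.
apply: (@filterS _ F _ _ _ _ Fb) => -[y c].
rewrite /attachment_collapse /=; case: eqP => [-> ->|_ /esym //].
by move/(attachment_nbhs_isolated _ _ bp): nW.
Qed.

Definition attachment_piece (i : option X) : topologicalType :=
  if i is Some _ then P else X.

Definition attachment_map (q : {i : option X & attachment_piece i}) :
    attachment X p :=
  match q with
  | existT None x => (x, p)
  | existT (Some x) b => (x, b)
  end.

Lemma attachment_map_quotient : quotient_map attachment_map.
Proof.
split=> [|U]; first by apply/seteqP; split=> // -[x b] _;
  exists (existT attachment_piece (Some x) b).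
rewrite sigT_openP; split=> [oU [x|]|oU].
- apply: open_comp oU => b _ W nW; have [bp|bp] := pselect (b = p).
    by move: nW; rewrite bp => /attachment_nbhs_base/nbhs_singleton.
  move: nW => /(attachment_nbhs_isolated _ _ bp) Wxb.
  by apply: filterS (isoP bp) => _ ->.
- apply: open_comp oU => x _ W /attachment_nbhs_base; apply: filterS => y.
  exact: nbhs_singleton.
rewrite openE => -[x b] Uxb; have [bp|bp] := pselect (b = p); last first.
  exact/(attachment_nbhs_isolated _ _ bp).
rewrite bp in Uxb *; apply/attachment_nbhs_base.
(* Openness on the base handles [y] near [x]; openness on the copy at [y] then handles [b] near
   [p]. *)
have := open_nbhs_nbhs (conj (oU None) Uxb); apply: filterS => y Uy.
exact: open_nbhs_nbhs (conj (oU (Some y)) Uy).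
Qed.

End attachment_maps.

(** * Prime factors of spaces in [A] *)

Section prime_factor_nbhs.
Variables (X : topologicalType) (a : X).

Lemma prime_factor_nbhs_base (W : set (prime_factor a)) :
  nbhs (a : prime_factor a) W <-> nbhs (a : X) (W : set X).
Proof. by rewrite {1}/nbhs /= /prime_factor_nbhs eqxx. Qed.

Lemma prime_factor_nbhs_isolated (x : prime_factor a)
    (W : set (prime_factor a)) :
  x <> a -> nbhs x W <-> W x.
Proof.
move=> /eqP xa; rewrite {1}/nbhs /= /prime_factor_nbhs (negbTE xa).
exact: principal_filterP.
Qed.

End prime_factor_nbhs.

Lemma prime_factor_epireflective (A : space_class) (X : topologicalType)
    (a : X) :
  epireflective A -> ~ A I2 -> A bool -> A X -> A (prime_factor a).
Proof.
move=> epiA I2A Abool AX.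
have idc : continuous (idfun : prime_factor a -> X).
  move=> x U nU; have [xa|xa] := pselect (x = a).
    by rewrite xa in nU *; exact/prime_factor_nbhs_base.
  exact/(prime_factor_nbhs_isolated U xa)/(nbhs_singleton nU).
apply: (epireflective_initial epiA) => [x y /(_ _ _ AX idc) //|].
move=> x F FF cvgF W nW; have [xa|xa] := pselect (x = a).
  rewrite xa in nW cvgF *; move/prime_factor_nbhs_base: nW.
  exact: cvgF _ _ AX idc W.
have Wx : W x by exact/(prime_factor_nbhs_isolated W xa).
(* The identity to [X] settled convergence at [a]; any other [x] needs a map into [A] that isolates
   it. *)
suff [Y [f [AY fc [U Ux UW]]]] : exists (Y : topologicalType)
    (f : prime_factor a -> Y), [/\ A Y, continuous f &
    exists2 U, nbhs (f x) U & f @^-1` U `<=` [set x]].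
  by apply: (@filterS _ F _ (f @^-1` U)) (cvgF _ _ AY fc U Ux) => y /UW ->.
have cont_at_a (Y : topologicalType) (f : prime_factor a -> Y) :
    (forall U, nbhs (f a) U -> nbhs a (f @^-1` U)) -> continuous f.
  move=> fa y U; have [->|ya] := pselect (y = a).
    by move=> nU; apply/prime_factor_nbhs_base; exact: fa.
  move=> /nbhs_singleton Ufy.
  exact/(prime_factor_nbhs_isolated (f @^-1` U) ya).
have [aNx|aNx] := pselect (exists2 V, nbhs a V & ~ V x).
  case: aNx => V aV Vx; exists bool, (fun y : X => y == x); split=> //.
    apply: cont_at_a => U; rewrite (introF eqP (nesym xa)).
    move=> /nbhs_singleton Uf.
    by apply: filterS aV => y Vy /=; case: eqP => // yx; rewrite yx in Vy.
  exists [set true] => [|y /= /eqP //].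
  by rewrite eqxx; exact/principal_filterP.
(* Now every neighborhood of [a] contains [x], so some [U] around [x] misses [a], and the map fixing
   [x] and sending the rest to [a] is continuous. *)
have [//|[U xU Ua]] := not_indistinguishable epiA I2A AX (nesym xa).
exists X, (fun y : X => if y == x then x else a); split=> //.
  apply: cont_at_a => V; rewrite (introF eqP (nesym xa)) => aV.
  apply: filterE => y /=; case: eqP => _; last exact: nbhs_singleton aV.
  by apply: contrapT => Vx; apply: aNx; exists V.
exists U; first by rewrite eqxx.
by move=> y /=; case: eqP.
Qed.

(** * The prime factor as a quotient of a subspace of the attachment *)

Section prime_factor_quotient.
Variables (X P : topologicalType) (p : P) (a : X).
Hypothesis limp : limit_point setT p.

(** The equivalence keeps [(a, p)] and the pairs [(x, b)] with [x <> a] and [b <> p]. *)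
Definition attachment_trace : set (attachment X p) :=
  [set q | q.1 = a <-> q.2 = p].

Definition attachment_trace_fst (z : attachment_trace) : prime_factor a :=
  (val z).1.

Lemma attachment_trace_fst_continuous : continuous attachment_trace_fst.
Proof.
move=> [[x b] Sz] U; have /= xb := set_mem Sz.
rewrite /attachment_trace_fst /= => nU; apply/set_type_nbhsP.
exists [set q | U q.1] => //=; have [bp|bp] := pselect (b = p); last first.
  by apply/(attachment_nbhs_isolated _ _ bp); exact: nbhs_singleton nU.
have xa : x = a := xb.2 bp; rewrite bp; rewrite xa in nU *.
move/prime_factor_nbhs_base: nU => nU.
exact: (@attachment_fst_continuous X P p (a, p) U).
Qed.

Lemma attachment_trace_fst_quotient : quotient_map attachment_trace_fst.
Proof.
have [b bp] : exists b, b <> p.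
  by have [b [/eqP bp _ _]] := limp (@filterT _ (nbhs p) _); exists b.
split=> [|U].
  apply/seteqP; split=> // x _; have [xa|xa] := pselect (x = a).
    have S0 : attachment_trace (a, p) by [].
    by exists (exist _ (a, p) (mem_set S0)).
  have Sxb : attachment_trace (x, b) by split.
  by exists (exist _ (x, b) (mem_set Sxb)).
split=> [oU|].
  by apply: open_comp oU => z _; exact: attachment_trace_fst_continuous.
rewrite !openE => oU x Ux; have [xa|xa] := pselect (x = a); last first.
  exact/(prime_factor_nbhs_isolated U xa).
rewrite xa in Ux *; apply/prime_factor_nbhs_base.
have S0 : attachment_trace (a, p) by [].
have /set_type_nbhsP[V /attachment_nbhs_base nV VU] :=
  oU (exist _ (a, p) (mem_set S0)) Ux.
(* Since [p] is not isolated, [V] contains some [(y, c)] with [c <> p], which lies in the trace when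
   [y <> a]. *)
apply: filterS nV => y /limp[c [/eqP cp _ Vyc]].
have [->//|ya] := pselect (y = a).
have Syc : attachment_trace (y, c) by split.
exact: VU (exist _ (y, c) (mem_set Syc)) Vyc.
Qed.

End prime_factor_quotient.

Theorem corollary3p12 (A B : space_class)
  (epiA : epireflective A) (I2A : ~ A I2) (hadB : HAD_class A B)
  (primeB : exists2 P : topologicalType, B P & prime_space P) :
  closed_under_prime_factors B.
Proof.
case: hadB => -[_ BA Badd Bdiv] Bher.
case: primeB => P BP [p [limp uniqp]].
have isoP b : b <> p -> nbhs b [set b].
  by move=> bp; apply: isolated_nbhs => /uniqp /esym.
(* The two copies of [p] in the sum of two copies of [P] form a discrete two-point subspace. *)
have Abool : A bool.
  pose f (b : bool) := existT (fun=> P) b p : {_ : bool & P}.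
  have Asum : A {_ : bool & P} by apply: BA; exact: Badd.
  have fc : continuous f.
    by move=> b U /nbhs_singleton Ufb; exact/principal_filterP.
  apply: (epireflective_initial epiA) => [b b' /(_ _ _ Asum fc) []//|].
  move=> b F FF /(_ _ _ Asum fc) cvgF W /principal_filterP Wb.
  have /cvgF Fb : nbhs (f b) (existT (fun=> P) b @` setT).
    by apply: existT_nbhs; exact: filterT.
  by apply: (@filterS _ F _ _ _ _ Fb) => b' /= [c _ []] <-.
move=> X a BX.
have BQ : B (attachment X p).
  apply: (Bdiv _ _ _ (attachment_map_quotient X isoP)).
    by apply: Badd => -[].
  by apply: attachment_epireflective => //; exact: BA.
(* Heredity puts the trace in [B]; divisibility then needs the prime factor to lie in [A]. *)
apply: (Bdiv _ _ _ (attachment_trace_fst_quotient a limp)).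
  exact: Bher.
by apply: prime_factor_epireflective => //; exact: BA.
Qed.
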